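(* For every $\varepsilon\in(0,1)$ and $q\in\mathbb{N}$, there exists an integer $t_3=t_3(q,\varepsilon)$ such that for every integer $t\ge t_3$ and all $k_1,k_2,\dots,k_q\in\mathbb{N}$ satisfying $\sum_{j=1}^q k_j\le (2-\varepsilon)t$, there exists a $K_t$-minor-free graph $G$ that is not $\{k_1,k_2,\dots,k_q\}$-choosable.
   Context: $\mathbb{N}$ denotes the positive integers. All graphs are finite and simple. A graph is $K_t$-minor-free if $K_t$ cannot be obtained from a subgraph of it by contracting edges. A list assignment $L$ of a graph $G$ assigns to each vertex $v$ a set $L(v)$ of colours; an $L$-colouring is a proper colouring $f$ with $f(v)\in L(v)$ for all $v$. For a multiset $\lambda=\{k_1,\dots,k_q\}$ of positive integers, a $\lambda$-list assignment of $G$ is a list assignment $L$ such that the colour set $\bigcup_{v\in V(G)}L(v)$ can be partitioned into $q$ sets $C_1,\dots,C_q$ with $|L(v)\cap C_i|\ge k_i$ for every $i$ and every vertex $v$. $G$ is $\lambda$-choosable if $G$ is $L$-colourable for every $\lambda$-list assignment $L$. *)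

(* Defs.v *)
From HB Require Import structures.
From mathcomp Require Import all_boot all_order all_algebra.
From mathcomp Require Import reals.
Set Implicit Arguments. Unset Strict Implicit. Unset Printing Implicit Defensive.

Definition simple_graph (T : finType) (e : rel T) : Prop :=
  symmetric e /\ irreflexive e.

Definition induced_connected (T : finType) (e : rel T) (S : {set T}) : Prop :=
  forall x y, x \in S -> y \in S ->
    connect [rel u v | [&& e u v, u \in S & v \in S]] x y.

Definition has_K_minor (T : finType) (e : rel T) (t : nat) : Prop :=
  exists B : 'I_t -> {set T},
    [/\ forall i, B i != set0,
        forall i, induced_connected e (B i),
        forall i j, i != j -> [disjoint B i & B j]
      & forall i j, i != j ->
          exists x y, [/\ x \in B i, y \in B j & e x y]].

Definition K_minor_free (T : finType) (e : rel T) (t : nat) : Prop :=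
  ~ has_K_minor e t.

Definition L_colourable (T : finType) (e : rel T) (L : T -> seq nat) : Prop :=
  exists f : T -> nat,
    (forall v, f v \in L v) /\ (forall x y, e x y -> f x != f y).

(* lambda = {k_0, ..., k_(q-1)} given by k : 'I_q -> nat.  L is a
   lambda-list assignment if there is a partition of the colours into
   classes C_0..C_(q-1) (cls c = index of the class of colour c) with
   |L(v) ∩ C_i| >= k_i for all v and i. *)
Definition lambda_list_assignment (T : finType) (q : nat) (k : 'I_q -> nat)
    (L : T -> seq nat) : Prop :=
  exists cls : nat -> 'I_q,
    forall v i, k i <= size (undup [seq c <- L v | cls c == i]).

Definition lambda_choosable (T : finType) (e : rel T) (q : nat)
    (k : 'I_q -> nat) : Prop :=
  forall L : T -> seq nat, lambda_list_assignment k L -> L_colourable e L.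

(* Main.v *)
Require Import Defs.
From HB Require Import structures.
From mathcomp Require Import all_boot all_order all_algebra.
From mathcomp Require Import reals.
From mathcomp Require Import zify lra.
Import Order.TTheory GRing.Theory Num.Theory.

(**
Fix a large [d] and put [n = d * s]. A counting argument gives a relation [N]
between two [n]-sets [A] and [B] in which every [b] is related to at most [s]
elements of [A], and which still contains a full product [X i * Y j] whenever
[X] and [Y] are families of [3 * s] disjoint nonempty sets of [A] and [B]:
colour [A * B] at random with [d ^ 2] colours and take a rare colour class. At
least [s] members of each family have at most [d] elements, so there are [s ^ 2]
disjoint products of bounded size, all of which fail to be monochromatic with
probability exp(- c * s ^ 2), against exp(O(s * log s)) choices of families.

Let the graph consist of a clique on [A] and, for every colouring [c] of [A], a
copy of a clique on [B], with [a] adjacent to every copy of [b] unless [N a b].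
In a [K_t]-minor with [t >= n + 3 * s], the branch sets missing [A] lie in a
single copy of [B], there are [3 * s] of them, and [3 * s] branch sets miss that
copy; these two families contradict the choice of [N]. On the other hand, give
the vertices of [A] a palette of fewer than [2 * n] colours, and remove
[c a] for all [a] with [N a b] from the list of [b] in copy [c]. In a list
colouring extending [c], all [2 * n] vertices of [A] and copy [c] would get
distinct colours. Each list loses at most [s] colours, so it suffices that the
palette has [k i + s] colours in class [i].
*)

(** * Geometric decay against polynomial growth *)

Lemma expn_succ_Bernoulli w j : w ^ j * (w + j) <= w.+1 ^ j * w.
Proof.
elim: j => [|j IH]; first by rewrite !expn0 addn0.
rewrite !expnS; nia.
Qed.

(** For [W > 1], Bernoulli's inequality gives [(W / (W - 1))^W >= 1 + W / (W - 1) >= 2]. *)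
Lemma double_expn_pred_leq W : 0 < W -> 2 * W.-1 ^ W <= W ^ W.
Proof.
case: W => // -[|w] _; first by [].
have := expn_succ_Bernoulli w.+1 w.+2; rewrite /=.
move: (w.+1 ^ _) (w.+2 ^ _) => x y; nia.
Qed.

Lemma poly_geometric_decay W C e : 0 < W ->
  exists s0, forall s, s0 <= s -> C * s ^ e * W.-1 ^ s < W ^ s.
Proof.
(* This [K] fits [v * (e + 1)] blocks of length [W] into [s]. Each block halves [(1 - 1/W)^s], which
   offsets [e + 1] factors [s <= K * 2^v]; the one factor beyond [s^e] beats the constant. *)
move=> W0; pose K := W * e.+1.
exists (C * K ^ e.+1).+1 => s les.
pose v := s %/ K.
have K0 : 0 < K by rewrite muln_gt0 W0.
have ltsv : s <= K * 2 ^ v.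
  apply: (@leq_trans (K * v.+1)); first by rewrite mulnC ltnW // -ltn_divLR.
  by rewrite leq_mul2l ltn_expl ?orbT.
have le1 : s ^ e.+1 <= K ^ e.+1 * 2 ^ (v * e.+1).
  by rewrite expnM -expnMn leq_exp2r.
have le2 : 2 ^ (v * e.+1) * W.-1 ^ s <= W ^ s.
  have levs : W * (v * e.+1) <= s by rewrite mulnCA leq_divM.
  have le2X x : 2 ^ x * W.-1 ^ (W * x) <= W ^ (W * x).
    rewrite !expnM -expnMn; case: x => // x.
    by rewrite leq_exp2r // double_expn_pred_leq.
  rewrite -(subnKC levs) !expnD mulnA leq_mul //.
  by case: (_ - _) => // r; rewrite leq_exp2r // leq_pred.
have s0 : 0 < s by apply: leq_trans les.
rewrite -(ltn_pmul2r s0) -!mulnA [_ * s]mulnC.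
have Ws : 0 < W ^ s by rewrite expn_gt0 W0.
apply: (@leq_ltn_trans (C * K ^ e.+1 * W ^ s)); last by rewrite mulnC ltn_pmul2l.
rewrite -mulnA leq_mul2l; apply/orP; right.
rewrite mulnA -expnSr.
apply: (leq_trans (leq_mul le1 (leqnn _))).
by rewrite -mulnA leq_mul2l le2 orbT.
Qed.

(** * Colourings that avoid a colour on disjoint blocks *)

(** A random colouring is constantly [h] on a block with probability at least [1 / D^w],
    independently over disjoint blocks. The bound [(1 - 1 / D^w)^(size K)] appears with denominators
    cleared. *)
Lemma card_avoid_blocks (U J : finType) (D w : nat) (h : 'I_D)
    (Z : J -> {set U}) (K : seq J) :
  uniq K -> (forall i, #|Z i| <= w) ->
  (forall i j, i != j -> [disjoint Z i & Z j]) ->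
  #|[set g : {ffun U -> 'I_D} |
      all (fun i => ~~ [forall z in Z i, g z == h]) K]| * (D ^ w) ^ size K
  <= (D ^ w).-1 ^ size K * D ^ #|U|.
Proof.
move=> uK leZ disZ; elim: K uK => [|i K IH] /=.
  by move=> _; rewrite muln1 mul1n -[X in X ^ _]card_ord -card_ffun max_card.
case/andP=> iK /IH {IH}; set W := D ^ w; set G := [set g | _] => IH.
set G' := [set g | _].
pose H := [set g in G | [forall z in Z i, g z == h]].
have D0 : 0 < D by case: (h) => ?; apply: leq_ltn_trans.
have EG : #|G'| + #|H| = #|G|.
  rewrite -(cardsID [set g : {ffun U -> 'I_D} | [forall z in Z i, g z == h]] G).
  rewrite addnC; congr (_ + _); apply: eq_card => g; rewrite !inE //.
(* Overwriting [g] by [h] on [Z i] maps [G] to [H] with fibres of size at most [W]. *)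
have leGH : #|G| <= #|H| * W.
  pose F := [set f : {ffun U -> 'I_D} in pffun_on h (mem (Z i)) predT].
  have cF : #|F| <= W.
    by rewrite cardsE card_pffun_on card_ord leq_pexp2l // leZ.
  apply: (@leq_trans (#|H| * #|F|)); last by rewrite leq_mul2l cF orbT.
  rewrite -cardsX.
  pose phi (g : {ffun U -> 'I_D}) : {ffun U -> 'I_D} * {ffun U -> 'I_D} :=
    ([ffun z => if z \in Z i then h else g z],
     [ffun z => if z \in Z i then g z else h]).
  rewrite -(card_in_imset (f := phi)).
    apply/subset_leq_card/subsetP => _ /imsetP[g gG ->].
    rewrite !inE /=; apply/andP; split.
      apply/andP; split.
        move: gG; rewrite inE => /allP gG; apply/allP => j jK.
        have nji : i != j by apply: contraNneq iK => ->.
        apply: contra (gG j jK) => /forall_inP a; apply/forall_inP => z zj.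
        have := a z zj; rewrite ffunE ifN //.
        by rewrite (disjointFl (disZ _ _ nji) zj).
      by apply/forall_inP => z zi; rewrite ffunE zi.
    apply/pffun_onP; split=> //; apply/supportP => z zi.
    by rewrite ffunE ifN.
  move=> g g' _ _ [] /ffunP e1 /ffunP e2; apply/ffunP => z.
  by have := e1 z; have := e2 z; rewrite !ffunE; case: ifP.
have W0 : 0 < W by rewrite expn_gt0 D0.
have le' : #|G'| * W <= W.-1 * #|G|.
  move: leGH; rewrite -EG -(prednK W0) /= !mulnS mulnDr.
  by rewrite addnC leq_add2l [#|H| * _]mulnC [#|G'| * _]mulnC addnC leq_add2l.
rewrite !expnS mulnA; apply: (leq_trans (leq_mul le' (leqnn _))).
by rewrite -!mulnA leq_mul2l IH orbT.
Qed.

(** * Families of disjoint sets *)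

Lemma sum_card_disjointI (T I : finType) (X : I -> {set T}) (S : {set I})
    (Q : {set T}) :
  {in S &, forall i j, i != j -> [disjoint X i & X j]} ->
  \sum_(i in S) #|X i :&: Q| <= #|Q|.
Proof.
move=> dis.
under eq_bigr do rewrite -sum1_card.
under eq_bigr do under eq_bigl do rewrite inE.
rewrite (exchange_big_dep (mem Q)) /=; last by move=> i a _ /andP[].
rewrite -sum1_card; apply: leq_sum => a aQ.
case: (pickP (fun i => (i \in S) && (a \in X i))) => [i /andP[iS aX]|none].
  rewrite (bigD1 i) /=; last by rewrite iS aX aQ.
  rewrite big1 // => j /andP[/andP[jS /andP[aXj _]] ji].
  by have := dis _ _ jS iS ji => /disjointFr/(_ aXj); rewrite aX.
by rewrite big_pred0 // => i; rewrite andbA none.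
Qed.

Lemma card_meeting_disjoint (T I : finType) (X : I -> {set T}) (S : {set I})
    (Q : {set T}) :
  {in S &, forall i j, i != j -> [disjoint X i & X j]} ->
  #|[set i in S | X i :&: Q != set0]| <= #|Q|.
Proof.
move=> dis; apply: leq_trans (sum_card_disjointI _ _ _ _ Q dis).
rewrite -sum1_card.
rewrite [X in _ <= X](bigID (fun i => X i :&: Q != set0)) /=.
apply: leq_trans (leq_addr _ _).
under eq_bigl do rewrite inE.
by apply: leq_sum => i /andP[_]; rewrite -card_gt0.
Qed.

(** At most [s] disjoint sets of more than [d] elements fit into [d * s] points, so [s] smaller
    members remain. Listing each by [d] indices keeps the number of families low enough for a union
    bound. *)
Lemma small_blocks_enum (T I : finType) (X : I -> {set T}) (S : {set I}) d s :
  #|T| <= d * s -> 2 * s <= #|S| ->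
  {in S, forall i, X i != set0} ->
  {in S &, forall i j, i != j -> [disjoint X i & X j]} ->
  exists (f : 'I_s -> I) (x : {ffun 'I_s * 'I_d -> T}),
    [/\ forall i, f i \in S, forall i u, x (i, u) \in X (f i),
        forall i a, a \in X (f i) -> exists u, a = x (i, u)
      & forall i j u v, x (i, u) = x (j, v) -> i = j].
Proof.
move=> cT cS ne dis.
pose S' := [set i in S | #|X i| <= d].
have cbig : #|S :\: S'| <= s.
  have : \sum_(i in S :\: S') #|X i :&: setT| <= #|[set: T]|.
    apply: sum_card_disjointI => i j; rewrite !inE => /andP[_ iS] /andP[_ jS].
    exact: dis.
  have : \sum_(i in S :\: S') d.+1 <= \sum_(i in S :\: S') #|X i :&: setT|.
    apply: leq_sum => i; rewrite !inE setIT => /andP[iS' iS].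
    by move: iS'; rewrite iS /= -ltnNge.
  rewrite sum_nat_const cardsT => le1 le2.
  have := leq_trans (leq_trans le1 le2) cT.
  by rewrite mulnS (mulnC d); case: (posnP d) cT => [->|d0]; nia.
have cS' : s <= #|S'|.
  have := cardsID S' S; have : #|S :&: S'| <= #|S'| by rewrite subset_leq_card ?subsetIr.
  lia.
pose f (i : 'I_s) := enum_val (Ordinal (leq_trans (ltn_ord i) cS')).
have fS i : f i \in S /\ #|X (f i)| <= d.
  by have := enum_valP (Ordinal (leq_trans (ltn_ord i) cS')); rewrite inE => /andP[].
have fI : injective f.
  by move=> i j /enum_val_inj [] /val_inj.
have a0 i : {a | a \in X (f i)}.
  by apply/sigW; apply/set0Pn/ne; case: (fS i).
(* Blocks with fewer than [d] elements are padded by repeating [a0]. *)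
pose x : {ffun 'I_s * 'I_d -> T} := 
  [ffun p : 'I_s * 'I_d => nth (sval (a0 p.1)) (enum (X (f p.1))) p.2].
have xX i u : x (i, u) \in X (f i).
  rewrite ffunE /=; case: (ltnP u (size (enum (X (f i))))) => lu.
    by rewrite -mem_enum mem_nth.
  by rewrite nth_default // (svalP (a0 i)).
exists f, x; split => //.
- by move=> i; case: (fS i).
- move=> i a; rewrite -mem_enum => aX.
  have lu : index a (enum (X (f i))) < d.
    by apply: leq_trans (proj2 (fS i)); rewrite cardE index_mem.
  by exists (Ordinal lu); rewrite ffunE /= nth_index.
- move=> i j u v e; apply/eqP; rewrite -(inj_eq fI); apply: contraT => nij.
  have := dis _ _ (proj1 (fS i)) (proj1 (fS j)) nij.
  by move=> /disjointFr/(_ (xX i u)); rewrite e xX.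
Qed.

(** * The sparse relation *)

Definition block_pairs (T : finType) s d (x y : {ffun 'I_s * 'I_d -> T})
    (p : 'I_s * 'I_s) : {set T * T} :=
  [set (x (p.1, uv.1), y (p.2, uv.2)) | uv : 'I_d * 'I_d].

(** Union bound over the codes [(h, x, y)]: the [s]-th root of their number is polynomial in [s],
    while the [s]-th root of the failure probability [(1 - 1/W)^(s^2)] decays geometrically. *)
Lemma monochromatic_blocks d : 1 < d ->
  exists s0, forall s, s0 <= s ->
    exists g : {ffun 'I_(d * s) * 'I_(d * s) -> 'I_(d ^ 2)},
    forall (h : 'I_(d ^ 2)) (x y : {ffun 'I_s * 'I_d -> 'I_(d * s)}),
      (forall i j u v, x (i, u) = x (j, v) -> i = j) ->
      (forall i j u v, y (i, u) = y (j, v) -> i = j) ->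
      exists i j, forall u v, g (x (i, u), y (j, v)) = h.
Proof.
move=> d1; set D := d ^ 2; pose W := D ^ (d ^ 2).
have D0 : 0 < D by rewrite expn_gt0 ltnW.
have W0 : 0 < W by rewrite expn_gt0 D0.
have [s0 decay] := poly_geometric_decay W (D * d ^ (2 * d)) (2 * d) W0.
exists s0.+1 => s les; have s_gt0 : 0 < s by apply: leq_trans les.
pose U : finType := ('I_(d * s) * 'I_(d * s))%type.
pose code : finType :=
  ('I_D * ({ffun 'I_s * 'I_d -> 'I_(d * s)} * {ffun 'I_s * 'I_d -> 'I_(d * s)}))%type.
pose inj (x : {ffun 'I_s * 'I_d -> 'I_(d * s)}) :=
  [forall p, forall q, (x p == x q) ==> (p.1 == q.1)].
pose K := enum {: 'I_s * 'I_s}.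
have sizeK : size K = s * s by rewrite -cardE card_prod !card_ord.
(* Codes with overlapping blocks are given no bad colourings, as independence fails for them. *)
pose bad (c : code) : {set {ffun U -> 'I_D}} :=
  if inj c.2.1 && inj c.2.2 then
    [set g : {ffun U -> 'I_D} |
      all (fun p => ~~ [forall z in block_pairs _ _ _ c.2.1 c.2.2 p, g z == c.1]) K]
  else set0.
have injP x : inj x -> forall i j u v, x (i, u) = x (j, v) -> i = j.
  move=> /forallP/= inx i j u v e.
  by have /forallP/(_ (j, v)) := inx (i, u); rewrite e eqxx => /eqP.
have card_bad c : #|bad c| * W ^ (s * s) <= W.-1 ^ (s * s) * D ^ #|U|.
  rewrite /bad; case: ifP => [/andP[/injP i1 /injP i2]|_]; last by rewrite cards0 mul0n.
  rewrite -sizeK; apply: card_avoid_blocks; first exact: enum_uniq.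
    move=> p; apply: leq_trans (leq_imset_card _ _) _.
    by rewrite card_prod !card_ord.
  move=> p q npq; rewrite -setI_eq0; apply: contraNT npq.
  move=> /set0Pn[_ /setIP[/imsetP[uv _ ->] /imsetP[uv' _ [/i1 e1 /i2 e2]]]].
  by rewrite [p]surjective_pairing e1 e2 -surjective_pairing.
have card_code : #|{: code}| <= (D * d ^ (2 * d) * s ^ (2 * d)) ^ s.
  rewrite !card_prod !card_ffun !card_prod !card_ord.
  rewrite -mulnA -[d ^ _ * s ^ _]expnMn [X in _ <= X]expnMn.
  apply: leq_mul; first by rewrite -{1}(expn1 D) leq_pexp2l.
  by rewrite -expnD -expnM addnn -mul2n -mulnA (mulnC s).
have : #|\bigcup_c bad c| < #|{: {ffun U -> 'I_D}}|.
  have lt1 : (D * d ^ (2 * d) * s ^ (2 * d)) ^ s * W.-1 ^ (s * s) < W ^ (s * s).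
    by rewrite (expnM W) (expnM W.-1) -expnMn ltn_exp2r // decay // ltnW.
  have Ws : 0 < W ^ (s * s) by rewrite expn_gt0 W0.
  rewrite -(ltn_pmul2r Ws) card_ffun card_ord [X in _ < X]mulnC.
  apply: (@leq_ltn_trans (#|{: code}| * (W.-1 ^ (s * s) * D ^ #|U|))).
    apply: (@leq_trans (\sum_c (#|bad c| * W ^ (s * s)))).
      rewrite -big_distrl leq_mul2r; apply/orP; right.
      elim/big_rec2: _ => [|c n A _ IH]; first by rewrite cards0.
      by apply: leq_trans (leq_card_setU _ _) _; rewrite leq_add2l.
    by rewrite -sum_nat_const; apply: leq_sum => c _.
  have DU : 0 < D ^ #|U| by rewrite expn_gt0 D0.
  rewrite mulnA ltn_pmul2r //; apply: leq_ltn_trans lt1.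
  by rewrite leq_mul2r card_code orbT.
rewrite -cardsT => lt; have : ~~ ([set: {ffun U -> 'I_D}] \subset \bigcup_c bad c).
  by apply: contraL lt => /subset_leq_card; rewrite leqNgt.
case/subsetPn => g _ gNbad; exists g => h x y injx injy.
have : g \notin bad (h, (x, y)).
  by apply: contra gNbad => gb; apply/bigcupP; exists (h, (x, y)).
have injb (z : {ffun 'I_s * 'I_d -> 'I_(d * s)}) :
    (forall i j u v, z (i, u) = z (j, v) -> i = j) -> inj z.
  move=> iz; apply/forallP => -[i u]; apply/forallP => -[j v]; apply/implyP.
  by move=> /eqP/iz ->.
rewrite /bad /= !injb // inE => /allPn[[i j] _]; rewrite negbK => /forall_inP gh.
exists i, j => u v; apply/eqP; apply: gh.
by apply/imsetP; exists (u, v).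
Qed.

Lemma sparse_relation d : 1 < d ->
  exists s0, forall s, s0 <= s ->
    exists N : rel 'I_(d * s),
      (forall b, #|[set a | N a b]| <= s) /\
      forall (I : finType) (X Y : I -> {set 'I_(d * s)}) (SX SY : {set I}),
        3 * s <= #|SX| -> 3 * s <= #|SY| ->
        {in SX, forall i, X i != set0} -> {in SY, forall i, Y i != set0} ->
        {in SX &, forall i j, i != j -> [disjoint X i & X j]} ->
        {in SY &, forall i j, i != j -> [disjoint Y i & Y j]} ->
        exists i j, [/\ i \in SX, j \in SY &
          forall a b, a \in X i -> b \in Y j -> N a b].
Proof.
move=> d1; have [s0 mono] := monochromatic_blocks d d1.
exists s0 => s /mono[g gP].
pose M (h : 'I_(d ^ 2)) := [set p | g p == h].
(* The [d^2] classes partition [(d * s)^2] pairs, so some class has at most [s^2]. *)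
have [h leh] : exists h, #|M h| <= s ^ 2.
  apply/existsP; apply: contraT; rewrite negb_exists => /forallP big.
  have : \sum_(h : 'I_(d ^ 2)) (s ^ 2).+1 <= \sum_h #|M h|.
    by apply: leq_sum => h _; rewrite ltnNge.
  have -> : \sum_h #|M h| = (d * s) * (d * s).
    rewrite -[in RHS](card_ord (d * s)) -card_prod -sum1_card (partition_big g predT) //.
    apply: eq_bigr => h _; rewrite -sum1_card; apply: eq_bigl => p.
    by rewrite inE.
  rewrite sum_nat_const card_ord; nia.
pose N0 a b := g (a, b) == h.
(* The class size allows at most [s] heavy elements. Emptying their columns spoils at most [s] of
   the at least [3 * s] disjoint sets, leaving the [2 * s] that the enumeration needs. *)
pose heavy := [set b | s < #|[set a | N0 a b]|].
have card_heavy : #|heavy| <= s.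
  rewrite leqNgt; apply/negP => lts.
  have : \sum_(b in heavy) s.+1 <= #|M h|.
    have -> : #|M h| = \sum_b #|[set a | N0 a b]|.
      rewrite -sum1_card.
      rewrite (partition_big (fun p : 'I_(d * s) * 'I_(d * s) => p.2) predT) //=.
      apply: eq_bigr => b _.
      transitivity #|[set (a, b) | a in [set a | N0 a b]]|; last first.
        by rewrite card_imset => [|? ? []].
      rewrite sum1dep_card.
      apply: eq_card => -[a b']; rewrite !inE; apply/andP/imsetP => /=.
        by case=> Mh /eqP <-; exists a; rewrite ?inE.
      by case=> a'; rewrite !inE => gh [-> ->].
    rewrite [X in _ <= X](bigID (mem heavy)) /=; apply: leq_trans (leq_addr _ _).
    by apply: leq_sum => b; rewrite inE.
  rewrite sum_nat_const; nia.
exists (fun a b => N0 a b && (b \notin heavy)); split.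
  move=> b; case: (boolP (b \in heavy)) => hb.
    by rewrite eq_card0 // => a; rewrite in_set andbF.
  move: hb; rewrite inE -leqNgt; apply: leq_trans.
  by apply/subset_leq_card/subsetP => a; rewrite !inE => /andP[].
move=> I X Y SX SY cX cY neX neY disX disY.
pose SY' := SY :\: [set j in SY | Y j :&: heavy != set0].
have sSY : {subset SY' <= SY} by move=> j /setDP[].
have cY' : 2 * s <= #|SY'|.
  rewrite cardsD; have := card_meeting_disjoint _ _ _ _ heavy disY.
  set Q := [set j in SY | _]; move=> cQ.
  have : #|SY :&: Q| <= #|Q| by rewrite subset_leq_card ?subsetIr.
  lia.
have cn : #|'I_(d * s)| <= d * s by rewrite card_ord.
have cX' : 2 * s <= #|SX| by lia.
have [f [x [fS xX Xx ix]]] := small_blocks_enum _ _ _ _ d s cn cX' neX disX.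
have [|i j iS jS|f' [y [f'S yY Yy iy]]] :=
    small_blocks_enum _ _ Y SY' d s cn cY'.
- by move=> j /sSY/neY.
- by apply: disY; apply: sSY.
have [i [j gij]] := gP h x y ix iy.
exists (f i), (f' j); split => //; first exact: sSY.
move=> a b aX bY; have [[u ->] [v eb]] := (Xx _ _ aX, Yy _ _ bY).
rewrite /N0 {1}eb gij eqxx /=.
have /setDP[jSY] := f'S j; rewrite inE jSY negbK => /eqP/setP/(_ b).
by rewrite in_setI bY in_set0 /= => ->.
Qed.

(** * The glued graph and its minors *)

(* [N a b] means that [a] and [b] are NOT adjacent. *)
Definition glued_edge (A B C : finType) (N : A -> B -> bool)
    (v w : A + C * B) : bool :=
  match v, w with
  | inl a, inl a' => a != a'
  | inl a, inr (_, b) => ~~ N a b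
  | inr (_, b), inl a => ~~ N a b
  | inr (c, b), inr (c', b') => (c == c') && (b != b')
  end.

Lemma glued_edge_simple (A B C : finType) (N : A -> B -> bool) :
  simple_graph (glued_edge A B C N).
Proof.
split=> [[a|[c b]] [a'|[c' b']] | [a|[c b]]] //=; rewrite ?eqxx ?andbF //.
- by rewrite eq_sym.
- by rewrite (eq_sym c) (eq_sym b).
Qed.

(** No edge joins two copies, so a path that avoids [A] stays in its copy. *)
Lemma glued_connected_fibre (A B C : finType) (N : A -> B -> bool)
    (S : {set A + C * B}) c b :
  induced_connected (glued_edge A B C N) S -> (forall a, inl a \notin S) ->
  inr (c, b) \in S -> forall v, v \in S -> exists b', v = inr (c, b').
Proof.
move=> conn SA Scb v Sv.
have := conn _ _ Scb Sv => /connectP[p].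
elim: p (c) (b) {Scb} => [|w p IH] c0 b0 /=; first by move=> _ ->; exists b0.
case/andP=> /and3P[+ _ +]; case: w => [a|[c' b']]; first by rewrite (negbTE (SA a)).
by move=> /= /andP[/eqP <- _] _; apply: IH.
Qed.

Lemma glued_K_minor_free (A C : finType) (N : rel A) s t :
  #|A| + 3 * s <= t -> #|A| < t ->
  (forall (I : finType) (X Y : I -> {set A}) (SX SY : {set I}),
    3 * s <= #|SX| -> 3 * s <= #|SY| ->
    {in SX, forall i, X i != set0} -> {in SY, forall i, Y i != set0} ->
    {in SX &, forall i j, i != j -> [disjoint X i & X j]} ->
    {in SY &, forall i j, i != j -> [disjoint Y i & Y j]} ->
    exists i j, [/\ i \in SX, j \in SY &
      forall a b, a \in X i -> b \in Y j -> N a b]) ->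
  K_minor_free (glued_edge A A C N) t.
Proof.
move=> le_t ltt NP [S [neS connS disS adjS]].
have card_avoid (Q : {set A + C * A}) :
    #|Q| = #|A| -> t - #|A| <= #|[set i | S i :&: Q == set0]|.
  move=> cQ; rewrite -cQ leq_subLR -[X in X <= _]card_ord -cardsT.
  rewrite -(cardsID [set i | S i :&: Q == set0] setT) addnC.
  apply: leq_add; last by rewrite subset_leq_card ?subsetIr.
  apply: leq_trans (card_meeting_disjoint _ _ S setT Q _) => [|i j _ _]; last exact: disS.
  by apply/subset_leq_card/subsetP => i; rewrite !inE andbT.
pose QA : {set A + C * A} := [set inl a | a : A].
pose SY := [set i | S i :&: QA == set0].
have cSY : t - #|A| <= #|SY| by apply: card_avoid; rewrite card_imset // => ? ? [].
have SYA i : i \in SY -> forall a, inl a \notin S i.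
  rewrite inE => /eqP/setP Si a; have := Si (inl a).
  by rewrite in_setI in_set0 imset_f // andbT => ->.
have [i0 i0S] : exists i0, i0 \in SY.
  by apply/set0Pn; rewrite -card_gt0; apply: leq_trans cSY; rewrite subn_gt0.
(* Each branch set missing [A] lies in one copy, and adjacency to [S i0] makes this copy common to
   all. *)
have [c cP] : exists c, forall i, i \in SY -> forall v, v \in S i ->
    exists b, v = inr (c, b).
  have /set0Pn[[a|[c b]] vS] := neS i0; first by have := SYA _ i0S a; rewrite vS.
  exists c => i iS.
  have S0 := glued_connected_fibre _ _ _ _ _ _ _ (connS i0) (SYA _ i0S) vS.
  have [->|ni] := eqVneq i i0; first exact: S0.
  have [x [y [xS yS]]] := adjS _ _ ni.
  have [b' ->] := S0 _ yS; case: x xS => [a|[c' b'']] xS.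
    by have := SYA _ iS a; rewrite xS.
  move=> /= /andP[/eqP ec _]; rewrite {}ec in xS.
  exact: (glued_connected_fibre _ _ _ _ _ _ _ (connS i) (SYA _ iS) xS).
pose QB : {set A + C * A} := [set inr (c, b) | b : A].
pose SX := [set i | S i :&: QB == set0].
have cSX : t - #|A| <= #|SX| by apply: card_avoid; rewrite card_imset // => ? ? [].
pose X i := [set a | inl a \in S i]; pose Y i := [set b | inr (c, b) \in S i].
have SXP i b : i \in SX -> inr (c, b) \notin S i.
  rewrite inE => /eqP/setP/(_ (inr (c, b))).
  by rewrite in_setI in_set0 imset_f // andbT => ->.
(* Every edge leaving copy [c] ends in [A], so adjacent branch sets of the two families yield a pair
   outside [N]. *)
have adjXY i j : i \in SX -> j \in SY ->
    exists a b, [/\ a \in X i, b \in Y j & ~~ N a b].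
  move=> iX jY; have nij : i != j.
    apply: contraTneq jY => <-; apply/negP => iY.
    have /set0Pn[v vS] := neS i; have [b vb] := cP _ iY _ vS.
    by have := SXP i b iX; rewrite -vb vS.
  have [x [y [xS yS]]] := adjS _ _ nij; have [b yb] := cP _ jY _ yS.
  rewrite yb in yS *; case: x xS => [a|[c' b']] xS /=.
    by exists a, b; rewrite !inE.
  by case/andP => /eqP ec; rewrite ec (negbTE (SXP i b' iX)) in xS.
have cX : 3 * s <= #|SX| by lia.
have cY : 3 * s <= #|SY| by lia.
(* Adjacency to [S i0] and [S j0] will make the traces [X i] and [Y j] nonempty. *)
have [j0 j0S] : exists j0, j0 \in SX.
  by apply/set0Pn; rewrite -card_gt0; apply: leq_trans cSX; rewrite subn_gt0.
have [i iX|j jY|i j _ _ nij|i j _ _ nij|i [j [iX jY Nij]]] := NP _ X Y SX SY cX cY.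
- have [a [b [aX _ _]]] := adjXY _ _ iX i0S; apply/set0Pn; by exists a.
- have [a [b [_ bY _]]] := adjXY _ _ j0S jY; apply/set0Pn; by exists b.
- rewrite -setI_eq0; apply/eqP/setP => a; rewrite !inE.
  by apply/negP => /andP[ai aj]; rewrite (disjointFr (disS _ _ nij) ai) in aj.
- rewrite -setI_eq0; apply/eqP/setP => a; rewrite !inE.
  by apply/negP => /andP[ai aj]; rewrite (disjointFr (disS _ _ nij) ai) in aj.
have [a [b [aX bY]]] := adjXY _ _ iX jY.
by rewrite Nij.
Qed.

(** * Lists that admit no colouring *)

Lemma glued_not_choosable (A : finType) (N : rel A) q (k : 'I_q -> nat) s :
  0 < q -> (forall b, #|[set a | N a b]| <= s) ->
  \sum_(i < q) k i + q * s < 2 * #|A| ->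
  ~ lambda_choosable
      (glued_edge A A {ffun A -> {i : 'I_q & 'I_(k i + s)}} N) k.
Proof.
move=> q0 sparse small; set P := ({i : 'I_q & 'I_(k i + s)}%type) => choose.
pose Q (v : A + {ffun A -> P} * A) : {set P} :=
  if v is inr (c, b) then c @: [set a | N a b] else set0.
have cQ v : #|Q v| <= s.
  case: v => [a|[c b]] /=; first by rewrite cards0.
  by apply: leq_trans (leq_imset_card _ _) (sparse b).
pose L v := ~: Q v.
have [|f [fL f_proper]] := choose (fun v => [seq pickle x | x <- enum (L v)]).
  (* Numbers that encode no colour of [P] go to class [0] by default; they occur in no list. *)
  exists (fun n => if @unpickle P n is Some x then tag x else Ordinal q0) => v i.
  rewrite undup_id; last first.
    by rewrite filter_uniq // map_inj_uniq ?enum_uniq //; apply: pcan_inj pickleK.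
  rewrite filter_map size_map size_filter.
  rewrite (eq_count (a2 := fun x => tag x == i)); last first.
    by move=> x /=; rewrite pickleK.
  pose Ci := [set Tagged (fun i => 'I_(k i + s)) z | z : 'I_(k i + s)].
  have cCi : #|Ci| = k i + s.
    rewrite card_imset ?card_ord // => z z' e.
    by move/eqP: e; rewrite eq_Tagged /= => /eqP.
  have le_k : k i <= #|Ci :\: Q v|.
    rewrite cardsD cCi leq_subRL.
      by rewrite addnC leq_add2l (leq_trans _ (cQ v)) ?subset_leq_card ?subsetIr.
    apply: leq_trans (leq_addl _ _).
    by rewrite (leq_trans _ (cQ v)) ?subset_leq_card ?subsetIr.
  apply: (leq_trans le_k); rewrite cardE -size_filter.
  apply: uniq_leq_size => [|x]; first exact: enum_uniq.
  rewrite mem_enum => /setDP[/imsetP[z _ ->] xQ].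
  by rewrite mem_filter /= eqxx mem_enum inE.
have fP v : exists2 x, x \in L v & f v = pickle x.
  by have /mapP[x xL ->] := fL v; exists x => //; rewrite -mem_enum.
have [h hL fE] := fin_all_exists2 fP.
(* The decisive copy is indexed by the restriction of the given colouring to [A]. *)
pose c : {ffun A -> P} := [ffun a => h (inl a)].
pose F (v : A + A) : A + {ffun A -> P} * A :=
  match v with inl a => inl a | inr b => inr (c, b) end.
have neq v w : glued_edge _ _ _ N (F v) (F w) -> h (F v) != h (F w).
  by move=> /f_proper; rewrite !fE; apply: contraNneq => ->.
(* For a nonadjacent pair the colours differ because [c a] was removed from the list of [b]. *)
have neqAB a b : h (F (inl a)) != h (F (inr b)).
  have [Nab|Nab] := boolP (N a b); last exact: neq.
  have := hL (F (inr b)); rewrite inE; apply: contraNneq => <-.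
  by apply/imsetP; exists a; rewrite ?inE ?ffunE.
have hF_inj : injective (h \o F).
  move=> [a|b] [a'|b'] /eqP e; apply/eqP; apply: contraTT e => ne; try exact: neqAB.
  - exact: neq.
  - by rewrite eq_sym neqAB.
  - by apply: neq; rewrite /= eqxx.
have := leq_card _ hF_inj; rewrite card_sum card_tagged.
rewrite sumnE big_map big_enum /=.
under eq_bigr do rewrite card_ord.
rewrite big_split /= sum_nat_const card_ord addnn -mul2n => /(leq_trans small).
by rewrite ltnn.
Qed.

(** * Choice of parameters *)

Local Open Scope ring_scope.

(** Of the slack [8], the part [6] absorbs [2 * 3] from [d + 3]. The remaining [2], multiplied by
    [s + 1 > d], pays for the [2 * d] lost in rounding [t] up to a multiple of [d + 3]. *)
Lemma palette_size_bound (R : realFieldType) (eps : R) (q d s t K : nat) :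
  0 < eps < 1 -> q%:R + 8 <= eps * d%:R -> (d <= s)%N -> (t <= (d + 3) * s.+1)%N ->
  K%:R <= (2 - eps) * t%:R -> (K + q * s < 2 * (d * s))%N.
Proof.
move=> /andP[eps0 eps1] le_d ds le_t le_K.
rewrite -(ltr_nat R) natrD !natrM.
move: le_t ds; rewrite -!(ler_nat R) natrM natrD -natr1 => le_t ds.
have s0 : 0 <= s%:R :> R by [].
have le1 : K%:R <= (2 - eps) * ((d%:R + 3) * (s%:R + 1)).
  by apply: le_trans le_K _; rewrite ler_wpM2l //; lra.
have le2 : (2 - eps) * (d%:R + 3) <= 2 * d%:R - q%:R - 2 by nra.
have le3 : (2 - eps) * ((d%:R + 3) * (s%:R + 1)) <=
    (2 * d%:R - q%:R - 2) * (s%:R + 1) by rewrite mulrA ler_wpM2r //; lra.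
have q0 : 0 <= q%:R :> R by [].
nra.
Qed.

Theorem theorem4 (R : realType) (eps : R) (q : nat) :
  0 < eps < 1 -> (0 < q)%N ->
  exists t3 : nat, forall t : nat, (t3 <= t)%N ->
    forall k : 'I_q -> nat, (forall i, (0 < k i)%N) ->
      ((\sum_(i < q) k i)%N%:R <= (2 - eps) * t%:R) ->
      exists (T : finType) (e : rel T),
        [/\ simple_graph e, K_minor_free e t & ~ lambda_choosable e k].
Proof.
move=> eps01 q0.
have [d d1 le_d] : exists2 d, (1 < d)%N & q%:R + 8 <= eps * d%:R.
  have /andP[eps0 _] := eps01.
  (* The two successors ensure [1 < d]. *)
  exists (Num.bound ((q%:R + 8) / eps)).+2 => //.
  rewrite mulrC -ler_pdivrMr //.
  apply: le_trans (ltW (archi_boundP _)) _; last by rewrite ler_nat ltnW.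
  by rewrite divr_ge0 ?addr_ge0 // ltW.
have [s0 sparse] := sparse_relation d d1.
(* This threshold gives [s0 + d <= s], hence both [s0 <= s] and [d <= s]. *)
exists ((d + 3) * (s0 + d))%N => t le_t k _ le_k.
(* The largest [s] with [d * s + 3 * s <= t], as excluding the minor requires. *)
pose s := (t %/ (d + 3))%N.
have les : (s0 + d <= s)%N by rewrite leq_divRL 1?mulnC // addn3.
have [N [N_deg N_blocks]] := sparse s (leq_trans (leq_addr _ _) les).
have ds : (d <= s)%N := leq_trans (leq_addl _ _) les.
have le_ts : (t <= (d + 3) * s.+1)%N.
  by rewrite mulnC ltnW // -ltn_divLR // addn3.
have small := palette_size_bound _ _ _ _ _ _ _ eps01 le_d ds le_ts le_k.
have le_st : ((d + 3) * s <= t)%N by rewrite mulnC leq_divM.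
exists _, (glued_edge _ _ {ffun 'I_(d * s) -> {i : 'I_q & 'I_(k i + s)}} N).
split; first exact: glued_edge_simple.
- by apply: (glued_K_minor_free _ _ _ s) N_blocks; rewrite card_ord; nia.
- by apply: glued_not_choosable; rewrite ?card_ord.
Qed.
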